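(* ($L_p$ dual Aleksandrov-Fenchel inequality) Let $L_1,K_1,\ldots,K_n\in\mathcal S^n$, $p\ge 1$ and $1\le r\le n$. Then $$\frac{\widetilde V(L_1,K_2,\ldots,K_n)^{p+1}}{\widetilde V_{-p}(L_1,K_1,K_2,\ldots,K_n)}\ \le\ \prod_{i=1}^{r}\widetilde V(\underbrace{K_i,\ldots,K_i}_{r},K_{r+1},\ldots,K_n)^{p/r},$$ with equality if and only if $L_1,K_1,\ldots,K_r$ are all dilates of each other.
   Context: $\mathcal S^n$ is the set of star bodies (about the origin) in $\mathbb R^n$: compact sets $K$, star-shaped with respect to the origin, whose radial function $\rho(K,u)=\max\{c\ge 0: cu\in K\}$, $u\in S^{n-1}$, is positive and continuous. Two star bodies $K,L$ are dilates if $\rho(K,u)/\rho(L,u)$ is independent of $u\in S^{n-1}$. $S$ denotes spherical Lebesgue measure on $S^{n-1}$. The dual mixed volume of $K_1,\ldots,K_n\in\mathcal S^n$ is $\widetilde V(K_1,\ldots,K_n)=\frac1n\int_{S^{n-1}}\rho(K_1,u)\cdots\rho(K_n,u)\,dS(u)$. For $p\ge 1$, the $L_p$ multiple dual mixed volume of $L_1,K_1,\ldots,K_n\in\mathcal S^n$ is $$\widetilde V_{-p}(L_1,K_1,\ldots,K_n)=\frac1n\int_{S^{n-1}}\rho(K_1,u)^{-p}\rho(L_1,u)^{1+p}\rho(K_2,u)\cdots\rho(K_n,u)\,dS(u).$$ *)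

(* Defs.v *)
From HB Require Import structures.
From mathcomp Require Import all_boot all_order all_algebra.
From mathcomp Require Import all_classical all_reals all_analysis.

Set Implicit Arguments.
Unset Strict Implicit.
Unset Printing Implicit Defensive.

Import Order.TTheory GRing.Theory Num.Theory.
Import numFieldNormedType.Exports.

Local Open Scope classical_set_scope.
Local Open Scope ring_scope.

(* The norm carried by the library on ['rV[R]_n] is the maximum norm; it induces
   the usual topology, but the sphere has to be defined with [enorm]. *)
Definition enorm (R : realType) (n : nat) (x : 'rV[R]_n) : R :=
  Num.sqrt (\sum_(i < n) x ord0 i ^+ 2).

Definition unit_sphere (R : realType) (n : nat) : set 'rV[R]_n :=
  [set u | enorm u = 1].
Arguments unit_sphere : clear implicits.

Definition rV_display : measure_display. Proof. exact: default_measure_display. Qed.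

Section borel_rV.
Variables (R : realType) (n : nat).

Let borel_rV : set (set 'rV[R]_n) := <<s [set A | open A] >>.

Let borel_rV0 : borel_rV set0.
Proof. exact: sigma_algebra0. Qed.

Let borel_rVC A : borel_rV A -> borel_rV (~` A).
Proof. exact: sigma_algebraC. Qed.

Let borel_rV_bigcup (F : (set 'rV[R]_n)^nat) :
  (forall i, borel_rV (F i)) -> borel_rV (\bigcup_i (F i)).
Proof. exact: sigma_algebra_bigcup. Qed.

HB.instance Definition _ := @isMeasurable.Build rV_display 'rV[R]_n
  borel_rV borel_rV0 borel_rVC borel_rV_bigcup.

End borel_rV.

Lemma open_measurable_rV (R : realType) (n : nat) (U : set 'rV[R]_n) :
  open U -> measurable U.
Proof. exact: sub_gen_smallest. Qed.

Definition rV_cons (R : realType) (n : nat)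
    (p : measurableTypeR R * 'rV[R]_n) : 'rV[R]_n.+1 :=
  \row_i (if unlift ord0 i is Some j then p.2 ord0 j else p.1).

Lemma rV_cons0 (R : realType) (n : nat) (p : measurableTypeR R * 'rV[R]_n) :
  rV_cons p ord0 ord0 = p.1.
Proof. by rewrite mxE unlift_none. Qed.

Lemma rV_consS (R : realType) (n : nat) (p : measurableTypeR R * 'rV[R]_n)
    (j : 'I_n) :
  rV_cons p ord0 (lift ord0 j) = p.2 ord0 j.
Proof. by rewrite mxE liftK. Qed.

Lemma rV_cons_ball (R : realType) (n : nat)
    (p q : measurableTypeR R * 'rV[R]_n) (e : R) : 0 < e ->
  ball (rV_cons p) e (rV_cons q) <-> ball (p.1 : R) e q.1 /\ ball p.2 e q.2.
Proof.
move=> e0; split.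
- move=> [_ H]; split; first by have := H ord0 ord0; rewrite !rV_cons0.
  split=> // i j; have := H ord0 (lift ord0 j).
  by rewrite !rV_consS (ord1 i).
- move=> [H1 [_ H2]]; split=> // i j; rewrite (ord1 i).
  case: (unliftP ord0 j) => [k ->|->]; first by rewrite !rV_consS; exact: H2.
  by rewrite !rV_cons0.
Qed.

Lemma rat_ball (R : realType) (x e : R) :
  0 < e -> exists q : rat, ball (ratr q : R) e x.
Proof.
move=> e0; have /rat_in_itvoo[q] : x - e < x + e by rewrite ltrD2l gtrN.
by rewrite in_itv /= -ltr_distl => H; exists q.
Qed.

Lemma measurable_rV_cons (R : realType) (n : nat) :
  measurable_fun [set: measurableTypeR R * 'rV[R]_n] (@rV_cons R n).
Proof.
apply: (measurability [set A : set 'rV[R]_n.+1 | open A]) => //.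
move=> _ [U oU <-]; rewrite setTI.
pose box (z : (rat * 'rV[rat]_n) * nat) : set (measurableTypeR R * 'rV[R]_n) :=
  (ball (ratr z.1.1 : R) z.2.+1%:R^-1) `*`
  (ball (map_mx ratr z.1.2 : 'rV[R]_n) z.2.+1%:R^-1).
pose F z := if pselect (box z `<=` @rV_cons R n @^-1` U) then box z else set0.
suff -> : @rV_cons R n @^-1` U = \bigcup_z F z.
  apply: countable_bigcupT_measurable; first exact: countableP.
  move=> z; rewrite /F; case: pselect => [?|?]; last exact: measurable0.
  apply: measurableX.
    exact: measurable_realfun.measurable_ball.
  apply: open_measurable_rV; exact: ball_open.
apply/seteqP; split=> [p Up|p [z _]]; last first.
  by rewrite /F; case: pselect => [H /H|].
have /nbhs_ballP[e /= e0 eU] : nbhs (rV_cons p) U by exact: open_nbhs_nbhs.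
have e20 : 0 < e / 2 by rewrite divr_gt0.
have [k ke] : exists k, (k.+1%:R^-1 : R) < e / 2.
  by have [k _ /(_ k (leqnn k))] := near_infty_natSinv_lt (PosNum e20); exists k.
have k0 : 0 < k.+1%:R^-1 :> R by rewrite invr_gt0.
have [q0 pq0] := rat_ball p.1 k0.
have /choice[q pq] : forall j : 'I_n, exists y : rat,
  ball (ratr y : R) k.+1%:R^-1 (p.2 ord0 j) by move=> j; exact: rat_ball.
pose z := ((q0, \row_j q j) : rat * 'rV[rat]_n, k).
have boxp : box z p.
  split=> //=; split=> // i j; rewrite (ord1 i) !mxE; exact: pq.
exists z => //; rewrite /F; case: pselect => // nb; exfalso; apply: nb => y [/= y1 y2]; apply: eU.
apply: (@le_ball _ _ _ (k.+1%:R^-1 + k.+1%:R^-1)).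
  by rewrite [leRHS]splitr lerD// ltW.
pose c : measurableTypeR R * 'rV[R]_n := (ratr q0, map_mx ratr (\row_j q j)).
apply: (@ball_triangle _ _ (rV_cons c)).
  apply: ball_sym; apply/rV_cons_ball => //.
apply/rV_cons_ball => //.
Qed.

Lemma continuous_measurable_rV (R : realType) (n : nat) (D : set 'rV[R]_n)
    (f : 'rV[R]_n -> R) :
  open D -> {in D, continuous f} -> measurable_fun D f.
Proof.
move=> oD cf; apply: (measurability (@measurable_realfun.RGenOpens.G R)).
  exact: measurable_realfun.RGenOpens.measurableE.
move=> _ [_ [a [b ->]] <-]; apply: open_measurable_rV.
exact/(continuous_inP _ oD).1/interval_open.
Qed.

Definition rV_uncons (R : realType) (n : nat) (x : 'rV[R]_n.+1) :
    measurableTypeR R * 'rV[R]_n :=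
  (x ord0 ord0, \row_j x ord0 (lift ord0 j)).

Lemma rV_consK (R : realType) (n : nat) :
  cancel (@rV_cons R n) (@rV_uncons R n).
Proof.
move=> [t v]; rewrite /rV_uncons rV_cons0; congr pair.
by apply/rowP => j; rewrite mxE rV_consS.
Qed.

Lemma rV_unconsK (R : realType) (n : nat) :
  cancel (@rV_uncons R n) (@rV_cons R n).
Proof.
move=> x; apply/rowP => i; rewrite mxE.
by case: unliftP => [j|] ->//=; rewrite mxE.
Qed.

Lemma measurable_rV_uncons (R : realType) (n : nat) :
  measurable_fun [set: 'rV[R]_n.+1] (@rV_uncons R n).
Proof.
apply: measurable_fun_pair.
  apply: continuous_measurable_rV; first exact: openT.
  by move=> x _; exact: coord_continuous.
apply: (measurability [set A : set 'rV[R]_n | open A]) => //.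
move=> _ [U oU <-]; rewrite setTI; apply: open_measurable_rV.
apply: open_comp => // x _.
move=> A /= [P nP PA]; rewrite nbhs_filterE /=.
exists (fun i j => if unlift ord0 j is Some k then P ord0 k else setT).
  move=> i j; case: unliftP => [k ->|_]; last exact: filterT.
  by have := nP ord0 k; rewrite mxE (ord1 i).
move=> y Hy; apply: PA => i j; rewrite mxE (ord1 i).
by have := Hy ord0 (lift ord0 j); rewrite liftK.
Qed.

Definition leb_cons (R : realType) (n : nat)
    (mu : {sigma_finite_measure set 'rV[R]_n -> \bar R}) :
    set 'rV[R]_n.+1 -> \bar R :=
  pushforward (@lebesgue_measure R \x mu)%E (@rV_cons R n).

Section leb_cons.
Variables (R : realType) (n : nat).
Variable mu : {sigma_finite_measure set 'rV[R]_n -> \bar R}.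

Let leb_cons0 : leb_cons mu set0 = 0%E.
Proof. by rewrite /leb_cons /pushforward preimage_set0 measure0. Qed.

Let leb_cons_ge0 A : (0 <= leb_cons mu A)%E.
Proof. by rewrite /leb_cons /pushforward; exact: measure_ge0. Qed.

Let leb_cons_sigma_additive : semi_sigma_additive (leb_cons mu).
Proof.
exact: (@measure_semi_sigma_additive _ _ _
  (measure_function_pushforward__canonical__measure_function_Measure
     (@lebesgue_measure R \x mu)%E (@measurable_rV_cons R n))).
Qed.

HB.instance Definition _ := isMeasure.Build _ _ _ (leb_cons mu)
  leb_cons0 leb_cons_ge0 leb_cons_sigma_additive.

Let leb_cons_sigma_finite : sigma_finite setT (leb_cons mu).
Proof.
have [F [FT ndF Foo]] := (sigma_finiteP _ _).1 (sigma_finiteT (@lebesgue_measure R)).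
have [G [GT ndG Goo]] := (sigma_finiteP _ _).1 (sigma_finiteT mu).
have FGT : \bigcup_k (F k `*` G k) = setT.
  rewrite -subTset -setXTT FT GT => -[x y] [/= [i _ Fi] [j _ Gj]].
  exists (maxn i j) => //; split.
    by move: x Fi; exact/subsetPset/ndF/leq_maxl.
  by move: y Gj; exact/subsetPset/ndG/leq_maxr.
exists (fun k => @rV_uncons R n @^-1` (F k `*` G k)).
  by rewrite -preimage_bigcup FGT preimage_setT.
move=> k; have [mF oF] := Foo k; have [mG oG] := Goo k; split.
  by rewrite -[X in measurable X]setTI; apply: measurable_rV_uncons => //; exact: measurableX.
rewrite /leb_cons /pushforward (_ : _ @^-1` _ = F k `*` G k).
  by rewrite product_measure1E// lte_mul_pinfty// ge0_fin_numE.
by rewrite -comp_preimage (_ : _ \o _ = id)//; apply/funext => p; exact: rV_consK.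
Qed.

HB.instance Definition _ := Measure_isSigmaFinite.Build _ _ _ (leb_cons mu)
  leb_cons_sigma_finite.

End leb_cons.

Fixpoint lebesgue_rV (R : realType) (n : nat) :
    {sigma_finite_measure set 'rV[R]_n -> \bar R} :=
  match n with
  | 0 => \d_(0 : 'rV[R]_0)
  | m.+1 => leb_cons (lebesgue_rV R m)
  end.

Lemma continuous_enorm (R : realType) (n : nat) :
  continuous (@enorm R n).
Proof.
move=> x; apply: (@continuous_comp _ _ _
    (fun x : 'rV[R]_n => \sum_(i < n) x ord0 i ^+ 2) (@Num.sqrt R)).
  apply: continuous_big => [|i _ y]; first exact: add_continuous.
  apply: (@continuous_comp _ _ _
    (fun x : 'rV[R]_n => x ord0 i) (fun t : R => t ^+ 2)).
    exact: coord_continuous.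
  exact: exprn_continuous.
exact: sqrt_continuous.
Qed.

Definition radial_cone (R : realType) (n : nat) (A : set 'rV[R]_n) :
    set 'rV[R]_n :=
  [set x | 0 < enorm x <= 1 /\ A ((enorm x)^-1 *: x)].

Lemma measurable_radial_cone (R : realType) (n : nat) (A : set 'rV[R]_n) :
  measurable A -> measurable (radial_cone A).
Proof.
move=> mA; pose D : set 'rV[R]_n := [set x | 0 < enorm x].
have oD : open D.
  apply: (open_comp (f := @enorm R n) (D := [set t : R | 0 < t])).
    by move=> x _; exact: continuous_enorm.
  exact: open_gt.
have mf : measurable_fun D (fun x : 'rV[R]_n => (enorm x)^-1 *: x).
  apply: (measurability [set A : set 'rV[R]_n | open A]) => //.
  move=> _ [U oU <-]; apply: open_measurable_rV.
  apply/(continuous_inP _ oD).1 => // x; rewrite inE /D /= => x0.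
  apply: (@continuousZ R ('rV[R]_n) ('rV[R]_n)) => //.
  by apply: continuousV; [rewrite gt_eqF|exact: continuous_enorm].
have mB : measurable [set x : 'rV[R]_n | enorm x <= 1].
  rewrite (_ : mkset _ = ~` (@enorm R n @^-1` [set t : R | 1 < t])); last first.
    by apply/seteqP; split => x /=; rewrite leNgt => /negP.
  apply: measurableC; apply: open_measurable_rV.
  apply: (open_comp (f := @enorm R n) (D := [set t : R | 1 < t])).
    by move=> x _; exact: continuous_enorm.
  exact: open_gt.
have mDA := mf (open_measurable_rV oD) _ mA.
have := measurableI _ _ mB mDA; congr measurable.
apply/seteqP; split => x; rewrite /radial_cone /D /=.
  by move=> [-> [-> ?]].
by move=> [/andP[-> ->]].
Qed.

(* The surface measure of a subset of the sphere is [n] times the volume of the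
   cone over it, i.e., the normalization is the one for which dx = t^(n-1) dt dS(u)
   in polar coordinates. It is carried by R^n: only the trace of [A] on the unit
   sphere matters. *)
Definition spherical_measure (R : realType) (n : nat) (A : set 'rV[R]_n) :
    \bar R :=
  (n%:R%:E * lebesgue_rV R n (radial_cone A))%E.

Section spherical_measure.
Variables (R : realType) (n : nat).

Let spherical_measure0 : spherical_measure (set0 : set 'rV[R]_n) = 0%E.
Proof.
rewrite /spherical_measure (_ : radial_cone set0 = set0) ?measure0 ?mule0//.
by apply/seteqP; split => x // [].
Qed.

Let spherical_measure_ge0 (A : set 'rV[R]_n) : (0 <= spherical_measure A)%E.
Proof. by rewrite /spherical_measure mule_ge0// lee_fin. Qed.

Let spherical_measure_sigma_additive :
  semi_sigma_additive (@spherical_measure R n).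
Proof.
move=> F mF tF mUF; rewrite /spherical_measure.
under eq_fun => k do rewrite -ge0_sume_distrr//.
rewrite (_ : radial_cone (\bigcup_k F k) = \bigcup_k radial_cone (F k)).
  apply: cvgeZl => //; apply: measure_semi_sigma_additive.
  - by move=> i; exact: measurable_radial_cone.
  - apply/trivIsetP => i j _ _ ij; apply/seteqP; split => // x [[_ Fi] [_ Fj]].
    move/trivIsetP: tF => /(_ i j Logic.I Logic.I ij)/seteqP[+ _].
    by move=> /(_ ((enorm x)^-1 *: x)); apply.
  - by apply: bigcupT_measurable => i; exact: measurable_radial_cone.
apply/seteqP; split => x; first by move=> [x1 [k _ Fk]]; exists k.
by move=> [k _ [x1 Fk]]; split => //; exists k.
Qed.

HB.instance Definition _ := isMeasure.Build _ _ _ (@spherical_measure R n)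
  spherical_measure0 spherical_measure_ge0 spherical_measure_sigma_additive.

End spherical_measure.

(* This is a maximum when K is a star body, by compactness. *)
Definition radial (R : realType) (n : nat) (K : set 'rV[R]_n) (u : 'rV[R]_n) :
    R :=
  sup [set c : R | 0 <= c /\ K (c *: u)].

Record star_body (R : realType) (n : nat) (K : set 'rV[R]_n) : Prop := {
  star_body_compact : compact K ;
  star_body_star_shaped :
    forall x (t : R), K x -> 0 <= t <= 1 -> K (t *: x) ;
  star_body_radial_gt0 : forall u, unit_sphere R n u -> 0 < radial K u ;
  star_body_radial_continuous : {within unit_sphere R n, continuous (radial K)}
}.

Definition dilates (R : realType) (n : nat) (K L : set 'rV[R]_n) : Prop :=
  forall u v, unit_sphere R n u -> unit_sphere R n v ->
    radial K u / radial L u = radial K v / radial L v.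

Definition dual_mixed_volume (R : realType) (n : nat)
    (K : 'I_n -> set 'rV[R]_n) : R :=
  n%:R^-1 * \int[@spherical_measure R n]_(u in unit_sphere R n)
    \prod_(i < n) radial (K i) u.

(* Indices are shifted by one: [K ord0] is K_1. *)
Definition Lp_dual_mixed_volume (R : realType) (n : nat) (p : R)
    (L1 : set 'rV[R]_n.+1) (K : 'I_n.+1 -> set 'rV[R]_n.+1) : R :=
  n.+1%:R^-1 * \int[@spherical_measure R n.+1]_(u in unit_sphere R n.+1)
    (radial (K ord0) u `^ (- p) * radial L1 u `^ (1 + p) *
     \prod_(i < n.+1 | i != ord0) radial (K i) u).

(* Main.v *)
(* A single application of Hölder's inequality suffices. With w the product of
   the radial functions of K_2, ..., K_n and W that of K_(r+1), ..., K_n,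
     rho(L_1) w = (rho(K_1)^(-p) rho(L_1)^(1+p) w)^(1/(p+1)) *
                  prod_(i <= r) (rho(K_i)^r W)^(p/(r(p+1))),
   and the exponents sum to 1; raising the resulting inequality to the power
   p + 1 gives the claim. Equality in Hölder's inequality forces equality in the
   weighted AM-GM inequality at every point of the sphere, because the integrands
   are continuous and nonempty relatively open subsets of the sphere have positive
   measure; hence the ratios of the factors are constant on the sphere, which is
   the statement about dilates. The powers are handled by passing to logarithms
   of radial functions. *)

Require Import Defs.
From mathcomp Require Import all_boot all_order all_algebra.
From mathcomp Require Import all_classical all_reals all_analysis.
From mathcomp Require Import ring.

Set Implicit Arguments.
Unset Strict Implicit.
Unset Printing Implicit Defensive.

Import Order.TTheory GRing.Theory Num.Theory.
Import numFieldNormedType.Exports.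

Local Open Scope classical_set_scope.
Local Open Scope ring_scope.

(** * Positivity and finiteness of the spherical measure *)

(** Balls are cubes for the maximum norm, and [rV_cons] splits a cube into an interval times a cube
    of one dimension less. In dimension 0 the only point has mass 1. *)
Lemma lebesgue_rV_ball (R : realType) (n : nat) (x : 'rV[R]_n) (e : R) :
  0 < e -> lebesgue_rV R n (ball x e) = ((e *+ 2) ^+ n)%:E.
Proof.
move=> e0; elim: n x => [|n IH] x.
  rewrite /= /dirac/= indicE mem_set ?expr0//.
  by split=> // i j; case: j.
rewrite /= /leb_cons /pushforward.
rewrite (_ : _ @^-1` _ = ball (rV_uncons x).1 e `*` ball (rV_uncons x).2 e).
  rewrite product_measure1E; last 2 first.
  - exact: measurable_realfun.measurable_ball.
  - by apply: open_measurable_rV; exact: ball_open.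
  by rewrite IH exprS EFinM; congr (_ * _)%E; exact: (lebesgue_measure_ball _ (ltW e0)).
apply/seteqP; split=> y /=.
  by rewrite -{1}(rV_unconsK x) rV_cons_ball.
by rewrite -{3}(rV_unconsK x) rV_cons_ball.
Qed.

Lemma lebesgue_rV_open_gt0 (R : realType) (n : nat) (U : set 'rV[R]_n) :
  open U -> U !=set0 -> (0 < lebesgue_rV R n U)%E.
Proof.
move=> oU [x Ux]; have /nbhs_ballP[e /= e0 eU] : nbhs x U by exact: open_nbhs_nbhs.
apply: (@lt_le_trans _ _ (lebesgue_rV R n (ball x e))).
  by rewrite lebesgue_rV_ball// lte_fin exprn_gt0// mulrn_wgt0.
by apply: le_measure => //; rewrite inE; apply: open_measurable_rV => //;
  exact: ball_open.
Qed.

Lemma le_coord_enorm (R : realType) (n : nat) (x : 'rV[R]_n) i :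
  `|x ord0 i| <= enorm x.
Proof.
rewrite -sqrtr_sqr; apply: ler_wsqrtr.
by rewrite (bigD1 i)//= lerDl sumr_ge0// => j _; exact: sqr_ge0.
Qed.

Lemma enormZ (R : realType) (n : nat) (a : R) (x : 'rV[R]_n) :
  enorm (a *: x) = `|a| * enorm x.
Proof.
rewrite /enorm -sqrtr_sqr -sqrtrM ?sqr_ge0// mulr_sumr; congr Num.sqrt.
by apply: eq_bigr => i _; rewrite mxE exprMn.
Qed.

(** The open cube of radius 1 misses the unit coordinate vectors, hence the radius 2. *)
Lemma enorm_le1_ball (R : realType) (n : nat) (x : 'rV[R]_n) :
  enorm x <= 1 -> ball (0 : 'rV[R]_n) 2 x.
Proof.
move=> x1; split=> // i j; rewrite (ord1 i) /ball/= mxE sub0r normrN.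
by rewrite (le_lt_trans (le_coord_enorm x j))// (le_lt_trans x1)// ltr1n.
Qed.

Lemma closed_unit_sphere (R : realType) (n : nat) : closed (unit_sphere R n).
Proof.
apply: (preimage_closed (f := @enorm R n) (D := [set 1])); last exact: closed_eq.
by move=> x _; exact: continuous_enorm.
Qed.

Lemma compact_unit_sphere (R : realType) (n : nat) : compact (unit_sphere R n).
Proof.
apply: bounded_closed_compact; last exact: closed_unit_sphere.
exists 2; split; first exact: num_real.
move=> M M2 x x1; apply/ltW/(lt_trans _ M2).
have x1le : enorm x <= 1 by rewrite x1.
have := enorm_le1_ball x1le.
by rewrite mx_norm_ball /ball_/= sub0r normrN.
Qed.

Lemma measurable_unit_sphere (R : realType) (n : nat) :
  measurable (unit_sphere R n).
Proof.
rewrite -[unit_sphere _ _]setCK; apply: measurableC; apply: open_measurable_rV.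
by apply: closed_openC; exact: closed_unit_sphere.
Qed.

Lemma spherical_measure_lty (R : realType) (n : nat) (A : set 'rV[R]_n) :
  measurable A -> (spherical_measure A < +oo)%E.
Proof.
move=> mA; rewrite /spherical_measure lte_mul_pinfty// ?lee_fin//.
apply: (@le_lt_trans _ _ (lebesgue_rV R n (ball 0 2))).
  apply: le_measure; rewrite ?inE.
  - exact: measurable_radial_cone.
  - by apply: open_measurable_rV; exact: ball_open.
  - by move=> x [/andP[_ ? _]]; exact: enorm_le1_ball.
by rewrite lebesgue_rV_ball// ltry.
Qed.

(** The cone contains the open set of points of norm strictly between 0 and 1 whose direction lies
    in [U]; half of a unit vector in [U] is such a point. *)
Lemma spherical_measure_open_gt0 (R : realType) (n : nat) (U : set 'rV[R]_n.+1) :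
  open U -> U `&` unit_sphere R n.+1 !=set0 ->
  (0 < spherical_measure (U `&` unit_sphere R n.+1))%E.
Proof.
move=> oU [u [Uu u1]]; rewrite /spherical_measure mule_gt0// ?lte_fin//.
pose D : set 'rV[R]_n.+1 := [set x | 0 < enorm x].
pose D1 : set 'rV[R]_n.+1 := [set x | enorm x < 1].
pose f (x : 'rV[R]_n.+1) := (enorm x)^-1 *: x.
have oD : open D.
  apply: (open_comp (f := @enorm R n.+1) (D := [set t : R | 0 < t])).
    by move=> x _; exact: continuous_enorm.
  exact: open_gt.
have oD1 : open D1.
  apply: (open_comp (f := @enorm R n.+1) (D := [set t : R | t < 1])).
    by move=> x _; exact: continuous_enorm.
  exact: open_lt.
have oV : open (D `&` f @^-1` U).
  apply/(continuous_inP _ oD).1 => // x; rewrite inE /D /= => x0.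
  apply: (@continuousZ R ('rV[R]_n.+1) ('rV[R]_n.+1)) => //.
  by apply: continuousV; [rewrite gt_eqF|exact: continuous_enorm].
have oW := openI oV oD1.
have fS x : D x -> enorm (f x) = 1.
  by move=> x0; rewrite enormZ gtr0_norm ?invr_gt0// mulVf// gt_eqF.
apply: (@lt_le_trans _ _ (lebesgue_rV R n.+1 (D `&` f @^-1` U `&` D1))).
  apply: lebesgue_rV_open_gt0 => //.
  have eu : enorm (2^-1 *: u) = 2^-1.
    by rewrite enormZ u1 mulr1 gtr0_norm.
  exists (2^-1 *: u); split; last by rewrite /D1/= eu invf_lt1// ltr1n.
  split; rewrite /D/= ?eu//.
  by rewrite /f eu scalerA invrK mulfV// scale1r.
apply: le_measure; rewrite ?inE.
- exact: open_measurable_rV.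
- apply: measurable_radial_cone; apply: measurableI; first exact: open_measurable_rV.
  exact: measurable_unit_sphere.
- move=> x [[Dx Ux] /ltW x1]; split; first by apply/andP.
  by split=> //; exact: fS.
Qed.

(** * Integration over the sphere *)

Section within_continuous.
Variables (R : realType) (T : topologicalType) (A : set T).
Implicit Types f g : T -> R.

Lemma within_continuousD f g : {within A, continuous f} ->
  {within A, continuous g} -> {within A, continuous (fun u => f u + g u)}.
Proof. by move=> cf cg u; apply: continuousD; [exact: cf|exact: cg]. Qed.

Lemma within_continuousM f g : {within A, continuous f} ->
  {within A, continuous g} -> {within A, continuous (fun u => f u * g u)}.
Proof. by move=> cf cg u; apply: continuousM; [exact: cf|exact: cg]. Qed.

Lemma within_continuous_cst a : {within A, continuous (fun _ => a : R)}.
Proof. by move=> u; exact: cst_continuous. Qed.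

Lemma within_continuous_sum (I : finType) (P : pred I)
    (F : I -> T -> R) :
  (forall i, P i -> {within A, continuous (F i)}) ->
  {within A, continuous (fun u => \sum_(i | P i) F i u)}.
Proof.
by move=> cF; apply: continuous_big => //; exact: add_continuous.
Qed.

Lemma within_continuous_expR f : {within A, continuous f} ->
  {within A, continuous (fun u => expR (f u))}.
Proof.
by move=> cf u; apply: continuous_comp; [exact: cf|exact: continuous_expR].
Qed.

Lemma within_continuous_ln f : (forall u, A u -> 0 < f u) ->
  {within A, continuous f} -> {within A, continuous (fun u => ln (f u))}.
Proof.
move=> f0 cf; rewrite continuous_subspace_in => u /set_mem Au.
by apply: continuous_comp; [exact: cf|apply: continuous_ln; exact: f0].
Qed.

End within_continuous.

(** Preimages of open intervals are traces on [D] of open sets. This covers the sphere, which is not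
    open. *)
Lemma within_continuous_measurable_rV (R : realType) (n : nat)
    (D : set 'rV[R]_n) (f : 'rV[R]_n -> R) :
  measurable D -> {within D, continuous f} -> measurable_fun D f.
Proof.
move=> mD /continuousP cf.
apply: (measurability (@measurable_realfun.RGenOpens.G R)).
  exact: measurable_realfun.RGenOpens.measurableE.
move=> _ [_ [a [b ->]] <-].
have /open_subspaceP[V oV] := cf _ (@interval_open R (BRight a) (BLeft b) isT isT).
rewrite [X in _ = X -> _]setIC => <-; apply: measurableI => //.
exact: open_measurable_rV.
Qed.

Section sphere_mean.
Variables (R : realType) (n : nat).
Local Notation S := (unit_sphere R n.+1).
Local Notation sigma := (@spherical_measure R n.+1).
Implicit Types f g : 'rV[R]_n.+1 -> R.

Lemma within_continuous_integrable_sphere f :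
  {within S, continuous f} -> sigma.-integrable S (EFin \o f).
Proof.
move=> cf; apply: measurable_bounded_integrable.
- exact: measurable_unit_sphere.
- by apply: spherical_measure_lty; exact: measurable_unit_sphere.
- by apply: within_continuous_measurable_rV => //; exact: measurable_unit_sphere.
- have /compact_bounded[M [_ mrt]] :=
    continuous_compact cf (@compact_unit_sphere R n.+1).
  by exists M; split; rewrite ?num_real // => ? ? ? ?; exact: mrt.
Qed.

Lemma unit_sphere_delta : S (delta_mx 0 0).
Proof.
rewrite /unit_sphere/= /enorm big_ord_recl big1 => [|i _].
  by rewrite mxE !eqxx addr0 expr1n sqrtr1.
by rewrite mxE /= expr0n.
Qed.

(** By continuity [f] exceeds half of a positive value on a nonempty relatively open part of the
    sphere, which has positive measure. *)
Lemma Rintegral_sphere_gt0 f : {within S, continuous f} ->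
  (forall u, S u -> 0 <= f u) -> (exists2 u, S u & 0 < f u) ->
  0 < \int[sigma]_(u in S) f u.
Proof.
move=> cf f0 [u0 Su0 fu0].
have mS := @measurable_unit_sphere R n.+1.
have intf := within_continuous_integrable_sphere cf.
pose c := f u0 / 2; have c0 : 0 < c by rewrite divr_gt0.
have /open_subspaceP[V oV VE] : open (f @^-1` [set t | c < t] : set (subspace S)).
  by move/continuousP : cf; apply; exact: open_gt.
have Vu0 : V u0.
  suff [] : (V `&` S) u0 by [].
  by rewrite VE; split=> //=; rewrite ltr_pdivrMr// ltr_pMr// ltr1n.
have mVS : measurable (V `&` S) by apply: measurableI => //; exact: open_measurable_rV.
have pos : (0 < sigma (V `&` S))%E.
  by apply: spherical_measure_open_gt0 => //; exists u0.
(* [fine] sends an infinite integral to 0, so finiteness has to accompany positivity. *)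
rewrite /Rintegral fine_gt0//; apply/andP; split; last first.
  by rewrite ltey_eq (integrable_fin_num mS intf).
apply: (@lt_le_trans _ _ (c%:E * sigma (V `&` S))%E).
  by rewrite mule_gt0// lte_fin.
rewrite -integral_cst//.
apply: (@le_trans _ _ (\int[sigma]_(u in V `&` S) (f u)%:E)%E).
  apply: ge0_le_integral => //.
  - by move=> x _; rewrite lee_fin ltW.
  - apply/measurable_realfun.measurable_EFinP; apply: (measurable_funS mS) => //.
    exact: within_continuous_measurable_rV.
  - move=> x Vx; rewrite lee_fin ltW//.
    by have [] : ((f @^-1` [set t | c < t]) `&` S) x by rewrite -VE.
apply: ge0_subset_integral => //.
  by apply/measurable_realfun.measurable_EFinP; exact: within_continuous_measurable_rV.
Qed.

(* Not an average over the sphere: the factor 1/n is that of dual mixed volumes. *)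
Definition sphere_mean f : R := n.+1%:R^-1 * \int[sigma]_(u in S) f u.

Lemma eq_sphere_mean f g : {in S, f =1 g} -> sphere_mean f = sphere_mean g.
Proof. by move=> fg; rewrite /sphere_mean (eq_Rintegral _ fg). Qed.

Lemma sphere_meanZ a f : {within S, continuous f} ->
  sphere_mean (fun u => a * f u) = a * sphere_mean f.
Proof.
move=> cf; rewrite /sphere_mean RintegralZl 1?mulrCA//.
  exact: measurable_unit_sphere.
exact: within_continuous_integrable_sphere.
Qed.

Lemma sphere_meanD f g : {within S, continuous f} -> {within S, continuous g} ->
  sphere_mean (fun u => f u + g u) = sphere_mean f + sphere_mean g.
Proof.
move=> cf cg; rewrite /sphere_mean RintegralD ?mulrDr//.
- exact: measurable_unit_sphere.
- exact: within_continuous_integrable_sphere.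
- exact: within_continuous_integrable_sphere.
Qed.

Lemma sphere_mean_gt0 f : {within S, continuous f} ->
  (forall u, S u -> 0 < f u) -> 0 < sphere_mean f.
Proof.
move=> cf f0; rewrite mulr_gt0// Rintegral_sphere_gt0//.
  by move=> u /f0/ltW.
by exists (delta_mx 0 0); [exact: unit_sphere_delta|by apply: f0; exact: unit_sphere_delta].
Qed.

Lemma sphere_mean_sum (I : finType) (P : pred I) (F : I -> 'rV[R]_n.+1 -> R) :
  (forall i, P i -> {within S, continuous (F i)}) ->
  sphere_mean (fun u => \sum_(i | P i) F i u) =
  \sum_(i | P i) sphere_mean (F i).
Proof.
(* Extending by 0 off [P] makes every term continuous, which the induction over the list of indices
   requires. *)
move=> cF; pose F' i := if P i then F i else fun=> 0.
have cF' i : {within S, continuous (F' i)}.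
  by rewrite /F'; case: ifPn => [/cF//|_]; exact: within_continuous_cst.
transitivity (sphere_mean (fun u => \sum_(i | P i) F' i u)).
  by apply: eq_sphere_mean => u _; apply: eq_bigr => i Pi; rewrite /F' Pi.
transitivity (\sum_(i | P i) sphere_mean (F' i)); last first.
  by apply: eq_bigr => i Pi; rewrite /F' Pi.
elim: (index_enum I) => [|i s IH].
  rewrite big_nil -[RHS](mul0r (sphere_mean (fun=> 0))) -sphere_meanZ.
    by apply: eq_sphere_mean => u _; rewrite big_nil mul0r.
  exact: within_continuous_cst.
rewrite big_cons -IH; case: ifPn => Pi.
  rewrite -sphere_meanD//.
    by apply: eq_sphere_mean => u _; rewrite big_cons Pi.
  by apply: continuous_big => [|j _]; [exact: add_continuous|exact: cF'].
by apply: eq_sphere_mean => u _; rewrite big_cons (negbTE Pi).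
Qed.

(** When the means agree, the difference is continuous, nonnegative and of integral 0, so it is
    positive nowhere. *)
Lemma sphere_mean_le_eq f g : {within S, continuous f} ->
  {within S, continuous g} -> (forall u, S u -> f u <= g u) ->
  sphere_mean f <= sphere_mean g /\
  (sphere_mean f = sphere_mean g -> forall u, S u -> f u = g u).
Proof.
move=> cf cg fg.
pose h u := g u + -1 * f u.
have ch : {within S, continuous h}.
  apply: within_continuousD => //; apply: within_continuousM => //.
  exact: within_continuous_cst.
have hE : sphere_mean h = sphere_mean g - sphere_mean f.
  rewrite sphere_meanD ?sphere_meanZ ?mulN1r//.
  by apply: within_continuousM => //; exact: within_continuous_cst.
have h0 u : S u -> 0 <= h u by move=> /fg; rewrite /h mulN1r subr_ge0.
split.
  by rewrite -subr_ge0 -hE mulr_ge0// Rintegral_ge0.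
move=> fgE u Su; apply/eqP; rewrite eq_le fg//= -subr_le0 -mulN1r -/(h u) leNgt.
apply/negP => hu.
have : 0 < sphere_mean h by rewrite mulr_gt0// Rintegral_sphere_gt0//; exists u.
by rewrite hE fgE subrr ltxx.
Qed.

End sphere_mean.

(** * Hölder's inequality with its equality case *)

Lemma powR_expR (R : realType) (x y : R) : expR x `^ y = expR (y * x).
Proof. by rewrite /powR expR_eq0 expRK. Qed.

(** Weighted AM-GM in exponential form: exp lies above its tangent at [m] and touches it only there,
    and the linear terms average out because [m] is the weighted mean. *)
Lemma expR_sum_le (R : realType) (I : finType) (P : pred I) (w x : I -> R) :
  (forall i, P i -> 0 < w i) -> \sum_(i | P i) w i = 1 ->
  let m := \sum_(i | P i) w i * x i in
  expR m <= \sum_(i | P i) w i * expR (x i) /\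
  (expR m = \sum_(i | P i) w i * expR (x i) -> forall i, P i -> x i = m).
Proof.
move=> w0 w1 m.
(* The gap between exp and its tangent at [m], divided by [expR m]. *)
pose d i := expR (x i - m) - (1 + (x i - m)).
have d0 i : 0 <= d i by rewrite subr_ge0 expR_ge1Dx.
have E : \sum_(i | P i) w i * expR (x i) - expR m =
    expR m * \sum_(i | P i) w i * d i.
  transitivity (expR m * (\sum_(i | P i) w i * expR (x i - m) -
      \sum_(i | P i) w i + (\sum_(i | P i) w i) * m - \sum_(i | P i) w i * x i)).
    rewrite w1 mul1r -/m addrK mulrBr mulr1 mulr_sumr; congr (_ - _).
    by apply: eq_bigr => i _; rewrite mulrCA -expRD subrKC.
  congr (_ * _); rewrite mulr_suml -sumrB -big_split -sumrB.
  by apply: eq_bigr => i _; rewrite /d /=; ring.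
have s0 : 0 <= \sum_(i | P i) w i * d i.
  by apply: sumr_ge0 => i /w0/ltW wi; rewrite mulr_ge0.
split; first by rewrite -subr_ge0 E mulr_ge0// expR_ge0.
move=> eqE i Pi; move/eqP: E; rewrite -eqE subrr eq_sym mulf_eq0 expR_eq0 /=.
rewrite psumr_eq0 => [/allP|j /w0/ltW wj]; last by rewrite mulr_ge0.
move=> /(_ i (mem_index_enum _)); rewrite Pi mulf_eq0 gt_eqF ?w0//= => di.
apply/eqP; rewrite -subr_eq0; apply/negPn/negP => /expR_gt1Dx.
by rewrite -subr_gt0 -/(d i) (eqP di) ltxx.
Qed.

Section sphere_holder.
Variables (R : realType) (n : nat).
Local Notation S := (unit_sphere R n.+1).
Local Notation sphere_mean := (@sphere_mean R n).

Lemma sphere_mean_expR_gt0 g : {within S, continuous g} ->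
  0 < sphere_mean (fun u => expR (g u)).
Proof.
move=> cg; apply: sphere_mean_gt0; first exact: within_continuous_expR.
by move=> u _; exact: expR_gt0.
Qed.

(* This is the convexity of g |-> ln (sphere_mean (expR g)); dividing each
   expR (g i) by its mean reduces it to the pointwise AM-GM inequality. *)
Lemma sphere_mean_holder (I : finType) (P : pred I) (w : I -> R)
    (g : I -> 'rV[R]_n.+1 -> R) :
  (forall i, P i -> 0 < w i) -> \sum_(i | P i) w i = 1 ->
  (forall i, P i -> {within S, continuous (g i)}) ->
  let lhs := sphere_mean (fun u => expR (\sum_(i | P i) w i * g i u)) in
  let rhs := \prod_(i | P i) sphere_mean (fun u => expR (g i u)) `^ w i in
  lhs <= rhs /\
  (lhs = rhs <-> forall i j, P i -> P j ->
     forall u v, S u -> S v -> g i u - g j u = g i v - g j v).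
Proof.
move=> w0 w1 cg lhs rhs.
have [c cE] : exists c, forall i, P i ->
    sphere_mean (fun u => expR (g i u)) = expR (c i).
  exists (fun i => ln (sphere_mean (fun u => expR (g i u)))) => i Pi.
  by rewrite lnK// posrE sphere_mean_expR_gt0//; exact: cg.
(* Normalization: each [expR (h i u)] has mean 1, so the bound to prove becomes 1. *)
pose h i u := g i u + - c i.
have ch i : P i -> {within S, continuous (h i)}.
  by move=> Pi; apply: within_continuousD; [exact: cg|exact: within_continuous_cst].
have che i Pi := within_continuous_expR (ch i Pi).
have hE i : P i -> sphere_mean (fun u => expR (h i u)) = 1.
  move=> Pi; transitivity (sphere_mean (fun u => expR (- c i) * expR (g i u))).
    by apply: eq_sphere_mean => u _; rewrite /h expRD mulrC.
  by rewrite sphere_meanZ ?cE// ?expRN ?mulVf ?expR_eq0//;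
    apply: within_continuous_expR; exact: cg.
have rhsE : rhs = expR (\sum_(i | P i) w i * c i).
  by rewrite expR_sum; apply: eq_bigr => i Pi; rewrite cE// powR_expR.
have csum (G : I -> 'rV[R]_n.+1 -> R) :
    (forall i, P i -> {within S, continuous (G i)}) ->
    {within S, continuous (fun u => \sum_(i | P i) w i * G i u)}.
  move=> cG; apply: within_continuous_sum => i Pi.
  by apply: within_continuousM; [exact: within_continuous_cst|exact: cG].
have chs := within_continuous_expR (csum _ ch).
have lhsE : lhs = rhs * sphere_mean (fun u => expR (\sum_(i | P i) w i * h i u)).
  rewrite -sphere_meanZ//; apply: eq_sphere_mean => u _.
  rewrite rhsE -expRD -big_split/=; congr expR; apply: eq_bigr => i _.
  by rewrite /h -mulrDr addrC subrK.
have rhs0 : 0 < rhs by rewrite rhsE expR_gt0.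
have mean1 : sphere_mean (fun u => \sum_(i | P i) w i * expR (h i u)) = 1.
  rewrite sphere_mean_sum; last first.
    move=> i Pi; apply: within_continuousM; last exact: che.
    exact: within_continuous_cst.
  rewrite -w1; apply: eq_bigr => i Pi.
  by rewrite sphere_meanZ ?hE ?mulr1//; exact: che.
have amgm u := expR_sum_le (h^~ u) w0 w1.
have [] := sphere_mean_le_eq chs (csum (fun i u => expR (h i u)) che)
  (fun u _ => (amgm u).1).
rewrite mean1 => le1 eq1; split; first by rewrite lhsE ler_piMr// ltW.
split=> [eqlr i j Pi Pj u v Su Sv|gE].
  (* Equality of the means forces equality in AM-GM at each point, where all the [h i] then
     coincide; so [g i - g j] is the constant [c i - c j]. *)
  have /eq1 hh : sphere_mean (fun u => expR (\sum_(i | P i) w i * h i u)) = 1.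
    by apply: (mulfI (lt0r_neq0 rhs0)); rewrite -lhsE mulr1.
  have H k l z : P k -> P l -> S z -> h k z = h l z.
    move=> Pk Pl Sz.
    by rewrite ((amgm z).2 (hh z Sz) k Pk) ((amgm z).2 (hh z Sz) l Pl).
  have E z : S z -> g i z - g j z = c i - c j.
    move=> Sz; rewrite -(subrK (c i) (g i z)) -/(h i z) (H i j z Pi Pj Sz) /h.
    by rewrite addrAC [X in X + _]addrAC subrr add0r addrC.
  by rewrite (E u Su) (E v Sv).
suff -> : lhs = rhs * 1 by rewrite mulr1.
rewrite lhsE -mean1; congr (_ * _); apply: eq_sphere_mean => u /set_mem Su.
have H i j : P i -> P j -> h i u = h j u.
  move=> Pi Pj; rewrite /h.
  (* Taking the mean of [expR (g i)] as a constant multiple of [expR (g j)] identifies the constant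
     difference of [g i] and [g j] as [c i - c j]. *)
  suff : c i = c j + (g i u - g j u) by move=> ->; ring.
  apply: expR_inj; rewrite expRD -(cE i Pi) -(cE j Pj) mulrC.
  rewrite -sphere_meanZ; last by apply: within_continuous_expR; exact: cg.
  apply: eq_sphere_mean => z /set_mem Sz.
  by rewrite -expRD (gE i j Pi Pj u z Su Sz) subrK.
(* An empty family would have total weight 0; [h i0] serves as the common value. *)
have [i0 Pi0] : exists i, P i.
  apply/existsP; rewrite -[X in is_true X]negbK negb_exists; apply/negP => /forallP P0.
  by move: w1; rewrite big_pred0 => [/eqP|i]; [rewrite eq_sym oner_eq0|exact/negbTE].
transitivity (expR (h i0 u)).
  congr expR; rewrite -[RHS]mul1r -w1 mulr_suml; apply: eq_bigr => i Pi.
  by rewrite (H i i0).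
rewrite -[LHS]mul1r -w1 mulr_suml; apply: eq_bigr => i Pi.
by rewrite (H i i0).
Qed.

End sphere_holder.

(** * Dual mixed volumes *)

Lemma powR_prod (R : realType) (I : finType) (P : pred I) (F : I -> R) (s : R) :
  (forall i, 0 <= F i) ->
  \prod_(i | P i) F i `^ s = (\prod_(i | P i) F i) `^ s.
Proof.
(* Nonnegativity of the partial products is carried along, since [powRM] asks for it. *)
move=> F0; suff [] : 0 <= \prod_(i | P i) F i /\
  \prod_(i | P i) F i `^ s = (\prod_(i | P i) F i) `^ s by [].
elim/big_rec2: _ => [|i y1 y2 _ [y10 ->]]; first by rewrite powR1.
by rewrite mulr_ge0// powRM.
Qed.

(** Splits off the one exceptional factor when Hölder's inequality is applied to a family indexed by
    an option type. *)
Lemma big_option (R : Type) (idx : R) (op : Monoid.com_law idx) (I : finType)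
    (P : pred (option I)) (F : option I -> R) : P None ->
  \big[op/idx]_(i | P i) F i =
  op (F None) (\big[op/idx]_(i | P (Some i)) F (Some i)).
Proof.
move=> PN; rewrite (bigD1 None)//=; congr (op _ _).
rewrite (reindex_omap Some id) => [|[i|]//=]; last by rewrite andbF.
by apply: eq_bigl => i; rewrite eqxx !andbT.
Qed.

Section star_bodies.
Variables (R : realType) (n : nat).
Local Notation S := (unit_sphere R n.+1).

Lemma within_continuous_ln_radial (M : set 'rV[R]_n.+1) : star_body M ->
  {within S, continuous (fun u => ln (radial M u))}.
Proof.
by move=> hM; apply: within_continuous_ln;
  [exact: star_body_radial_gt0|exact: star_body_radial_continuous].
Qed.

Lemma radialE (M : set 'rV[R]_n.+1) u : star_body M -> S u ->
  radial M u = expR (ln (radial M u)).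
Proof. by move=> hM Su; rewrite lnK// posrE star_body_radial_gt0. Qed.

(** Constant ratios become constant differences, the form of the equality case of
    [sphere_mean_holder]. *)
Lemma dilates_lnP (M N : set 'rV[R]_n.+1) : star_body M -> star_body N ->
  dilates M N <-> forall u v, S u -> S v ->
    ln (radial M u) - ln (radial N u) = ln (radial M v) - ln (radial N v).
Proof.
move=> hM hN.
have E u : S u -> radial M u / radial N u = expR (ln (radial M u) - ln (radial N u)).
  by move=> Su; rewrite expRD expRN -!radialE.
split=> H u v Su Sv; first by apply: expR_inj; rewrite -!E//; exact: H.
by rewrite (E u Su) (E v Sv) (H u v Su Sv).
Qed.

Lemma dual_mixed_volumeE (M : 'I_n.+1 -> set 'rV[R]_n.+1) :
  (forall i, star_body (M i)) ->
  dual_mixed_volume M =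
  sphere_mean (fun u => expR (\sum_(i < n.+1) ln (radial (M i) u))).
Proof.
move=> hM; apply: eq_sphere_mean => u /set_mem Su.
by rewrite expR_sum; apply: eq_bigr => i _; rewrite -radialE.
Qed.

(** Writing the exponent [- p] of the first body as [1 - (1 + p)] lets the remaining product run
    over all indices. *)
Lemma Lp_dual_mixed_volumeE (p : R) (L : set 'rV[R]_n.+1)
    (M : 'I_n.+1 -> set 'rV[R]_n.+1) :
  star_body L -> (forall i, star_body (M i)) ->
  Lp_dual_mixed_volume p L M =
  sphere_mean (fun u => expR ((1 + p) * (ln (radial L u) - ln (radial (M ord0) u)) +
    \sum_(i < n.+1) ln (radial (M i) u))).
Proof.
move=> hL hM; apply: eq_sphere_mean => u /set_mem Su.
under [in LHS]eq_bigr => i _ do rewrite (radialE (hM i) Su).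
rewrite [in LHS](radialE hL Su) [X in X `^ _](radialE (hM ord0) Su).
rewrite !powR_expR -expR_sum -!expRD; congr expR.
by rewrite [in RHS](bigD1 ord0)//=; ring.
Qed.

End star_bodies.

(* The dimension is n.+1 and indices are shifted by one: the bodies K_1, ..., K_r
   are the [K i] with i < r. *)
Theorem mainTheorem3 (R : realType) (n : nat) (L1 : set 'rV[R]_n.+1)
    (K : 'I_n.+1 -> set 'rV[R]_n.+1) (p : R) (r : nat)
    (hL1 : star_body L1) (hK : forall i, star_body (K i))
    (hp : 1 <= p) (hr : (1 <= r <= n.+1)%N) :
  let lhs :=
    dual_mixed_volume (fun j => if j == ord0 then L1 else K j) `^ (p + 1) /
      Lp_dual_mixed_volume p L1 K in
  let rhs :=
    \prod_(i < n.+1 | (i < r)%N)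
      dual_mixed_volume (fun j => if (j < r)%N then K i else K j) `^ (p / r%:R) in
  lhs <= rhs /\
  (lhs = rhs <->
    (forall i : 'I_n.+1, (i < r)%N -> dilates L1 (K i)) /\
    (forall i j : 'I_n.+1, (i < r)%N -> (j < r)%N -> dilates (K i) (K j))).
Proof.
move=> lhs rhs.
have [r0 rn] := andP hr.
have p0 : 0 < p by rewrite (lt_le_trans _ hp).
have p10 : 0 < p + 1 by rewrite addr_gt0.
have p1u : p + 1 != 0 by rewrite gt_eqF.
have rR : r%:R != 0 :> R by rewrite pnatr_eq0 -lt0n.
pose a u := ln (radial L1 u).
pose x i u := ln (radial (K i) u).
(* [G i] and [G0] are the logarithms of the integrands of the mixed volumes on the right and of the
   L_p mixed volume. *)
pose G i u := \sum_(j < n.+1) if (j < r)%N then x i u else x j u.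
pose G0 u := (1 + p) * (a u - x ord0 u) + \sum_(j < n.+1) x j u.
(* [None] indexes the L_p factor, of weight 1/(p+1); each of the [r] other factors has weight
   p/(r(p+1)). *)
pose P (i : option 'I_n.+1) := oapp (fun i : 'I_n.+1 => (i < r)%N) true i.
pose w (i : option 'I_n.+1) := oapp (fun=> p / r%:R / (p + 1)) (p + 1)^-1 i.
pose g (i : option 'I_n.+1) := oapp G G0 i.
have ca : {within unit_sphere R n.+1, continuous a} by exact: within_continuous_ln_radial.
have cx i : {within unit_sphere R n.+1, continuous (x i)} by exact: within_continuous_ln_radial.
have sum_lt_r (y : R) : \sum_(i < n.+1 | (i < r)%N) y = r%:R * y.
  by rewrite -(big_ord_widen n.+1 (fun=> y) rn) sumr_const card_ord mulr_natl.
have w0 i : P i -> 0 < w i.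
  by move=> _; case: i => [i|] /=; rewrite ?invr_gt0// !divr_gt0// ltr0n.
have w1 : \sum_(i | P i) w i = 1.
  by rewrite big_option//= sum_lt_r; field; rewrite p1u.
have cg i : P i -> {within unit_sphere R n.+1, continuous (g i)}.
  move=> _; case: i => [i|] /=.
    by apply: within_continuous_sum => j _; case: (j < r)%N.
  apply: within_continuousD; last exact: within_continuous_sum.
  apply: within_continuousM; first exact: within_continuous_cst.
  apply: within_continuousD => //.
  under eq_fun do rewrite -mulN1r.
  by apply: within_continuousM => //; exact: within_continuous_cst.
(* The slots beyond [r] hold the same bodies and cancel. *)
have GBG i j u : G i u - G j u = r%:R * (x i u - x j u).
  rewrite -sumrB -sum_lt_r [RHS]big_mkcond; apply: eq_bigr => k _.
  by case: ifP => //; rewrite subrr.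
have G0BG i u : G0 u - G i u =
    (1 + p) * (a u - x ord0 u) + \sum_(j < n.+1 | (j < r)%N) (x j u - x i u).
  rewrite -[LHS]addrA -sumrB [in RHS]big_mkcond; congr (_ + _).
  by apply: eq_bigr => k _; case: ifP => //; rewrite subrr.
pose X := dual_mixed_volume (fun j => if j == ord0 then L1 else K j).
pose F0 := Lp_dual_mixed_volume p L1 K.
pose D i := dual_mixed_volume (fun j : 'I_n.+1 => if (j < r)%N then K i else K j).
have F0E : F0 = sphere_mean (fun u => expR (g None u)) by exact: Lp_dual_mixed_volumeE.
have DE i : D i = sphere_mean (fun u => expR (g (Some i) u)).
  rewrite /D dual_mixed_volumeE => [|j]; last by case: ifP.
  apply: eq_sphere_mean => u _; congr expR; apply: eq_bigr => j _.
  by rewrite -(fun_if (fun M => ln (radial M u))).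
have XE : X = sphere_mean (fun u => expR (\sum_(i | P i) w i * g i u)).
  rewrite /X dual_mixed_volumeE => [|j]; last by case: ifP.
  apply: eq_sphere_mean => u _; congr expR.
  (* The difference of the two sides is the sum of [x i u - x j u] over all [i, j < r], which
     vanishes by antisymmetry. *)
  have sumG : \sum_(i < n.+1 | (i < r)%N) G i u = r%:R * \sum_(j < n.+1) x j u.
    apply/eqP; rewrite -subr_eq0 -sum_lt_r -sumrB.
    under eq_bigr => i _.
      rewrite -sumrB (eq_bigr (fun j : 'I_n.+1 => if (j < r)%N then x i u - x j u else 0)).
        rewrite -big_mkcond sumrB sum_lt_r; over.
      by move=> j _; case: ifP => //; rewrite subrr.
    by rewrite sumrB sum_lt_r -mulr_sumr subrr.
  rewrite big_option//= -mulr_sumr sumG /G0 !(bigD1 ord0 (P := xpredT))//=.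
  rewrite (eq_bigr (fun i => x i u)) => [|i /negbTE ->//]; rewrite -/(a u).
  by field; rewrite p1u rR.
have X0 : 0 < X.
  rewrite XE; apply: sphere_mean_expR_gt0; apply: within_continuous_sum => i Pi.
  by apply: within_continuousM; [exact: within_continuous_cst|exact: cg].
have F00 : 0 < F0 by rewrite F0E; apply: sphere_mean_expR_gt0; exact: (cg None).
have [le_holder eq_holder] := sphere_mean_holder w0 w1 cg.
(* [B] is the Hölder bound for [X]. Raised to the power [p + 1], the two sides of [X <= B] become
   [lhs * F0] and [rhs * F0]. *)
pose B := F0 `^ (p + 1)^-1 * \prod_(i < n.+1 | (i < r)%N) D i `^ (p / r%:R / (p + 1)).
have BE : \prod_(i | P i) sphere_mean (fun u => expR (g i u)) `^ w i = B.
  rewrite /B F0E.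
  under [in RHS]eq_bigr do rewrite DE.
  by rewrite big_option.
rewrite -XE BE in le_holder eq_holder.
have B0 : 0 <= B by rewrite (le_trans (ltW X0)).
have rhsE : rhs * F0 = B `^ (p + 1).
  rewrite powRM ?powR_ge0 ?prodr_ge0// => [|i _]; last exact: powR_ge0.
  rewrite -powRrM mulVf// powRr1 ?ltW// mulrC; congr (_ * _).
  rewrite -powR_prod => [|i]; last exact: powR_ge0.
  by apply: eq_bigr => i _; rewrite -powRrM divfK.
have lhsE : lhs * F0 = X `^ (p + 1) by rewrite divfK// gt_eqF.
split.
  by rewrite -(ler_pM2r F00) lhsE rhsE ge0_ler_powR// ?nnegrE// ltW.
transitivity (X = B).
  split=> [E|E].
    apply: (powR_injective p10); rewrite ?nnegrE// ?ltW//.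
    by rewrite -lhsE -rhsE E.
  by apply: (mulIf (lt0r_neq0 F00)); rewrite lhsE rhsE E.
(* Since [r >= 1], the index [ord0] is among the first [r] and can link [L1] to the other bodies. *)
rewrite eq_holder; pose i0 : 'I_n.+1 := ord0.
split=> [H|[HL HK] i j Pi Pj u v Su Sv].
  have HK (i j : 'I_n.+1) u v : (i < r)%N -> (j < r)%N -> unit_sphere R n.+1 u ->
      unit_sphere R n.+1 v -> x i u - x j u = x i v - x j v.
    move=> ir jr Su Sv; apply: (mulfI rR).
    by rewrite -!GBG; exact: (H (Some i) (Some j)).
  have HL u v : unit_sphere R n.+1 u -> unit_sphere R n.+1 v ->
      a u - x i0 u = a v - x i0 v.
    move=> Su Sv; have := H None (Some i0) isT r0 u v Su Sv.
    (* By [HK] the sums over [j < r] take the same value at [u] and [v]; they cancel, and so does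
       the nonzero factor [1 + p]. *)
    rewrite /= !G0BG (eq_bigr (fun j => x j v - x i0 v)) => [/addIr|j jr]; last exact: HK.
    by apply: mulfI; rewrite addrC.
  split=> [i ir|i j ir jr]; apply/dilates_lnP => // u v Su Sv; last exact: HK.
  have E z : a z - x i z = (a z - x i0 z) - (x i z - x i0 z).
    by rewrite opprB addrA subrK.
  by rewrite -/(a u) -/(a v) -/(x i u) -/(x i v) !E (HL u v) ?(HK i i0 u v).
have {}HL : a u - x i0 u = a v - x i0 v.
  by have /dilates_lnP := HL i0 r0; exact.
have {}HK (k l : 'I_n.+1) : (k < r)%N -> (l < r)%N -> x k u - x l u = x k v - x l v.
  by move=> kr lr; have /dilates_lnP := HK k l kr lr; exact.
(* By [G0BG], [G0 - G k] depends only on differences already known to be constant. *)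
have HG (k : 'I_n.+1) : (k < r)%N -> G0 u - G k u = G0 v - G k v.
  by move=> kr; rewrite !G0BG HL; congr (_ + _); apply: eq_bigr => l lr; exact: HK.
case: i j Pi Pj => [i|] [j|] //= ir jr.
- by rewrite !GBG HK.
- by apply: oppr_inj; rewrite !opprB HG.
- exact: HG.
- by rewrite !subrr.
Qed.
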